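(* The pseudovariety $\mathsf{DA}$ of all finite semigroups in which all regular elements are idempotents is $\omega$-reducible both for the pointlike problem and for the idempotent pointlike problem.
   Context: $\mathsf{S}$ is the pseudovariety of all finite semigroups, and for a finite set $A$, $\overline{\Omega}_A\mathsf{S}$ is the free profinite semigroup on $A$; its elements are called pseudowords. For a pseudovariety $\mathsf{V}$ of semigroups, $\overline{\Omega}_A\mathsf{V}$ is the free pro-$\mathsf{V}$ semigroup on $A$ and $p_{\mathsf{V}}:\overline{\Omega}_A\mathsf{S}\to\overline{\Omega}_A\mathsf{V}$ is the canonical projection. An implicit signature is a set $\sigma$ of pseudowords (elements of finitely generated free profinite semigroups, viewed as implicit operations) that contains binary multiplication. Pseudowords have a natural interpretation as operations on every profinite semigroup, so every profinite semigroup is a $\sigma$-algebra; $\Omega^\sigma_A\mathsf{S}$ is the $\sigma$-subalgebra of $\overline{\Omega}_A\mathsf{S}$ generated by $A$. The signature $\omega$ consists of multiplication and the unary operation $\_^\omega$, which in a finite semigroup maps $x$ to its unique idempotent power $x^\omega$. A nonempty subset $P$ of a finite semigroup $S$ is $\mathsf{V}$-pointlike (respectively $\mathsf{V}$-idempotent pointlike) if for every finite set $A$ and every onto continuous homomorphism $\varphi:\overline{\Omega}_A\mathsf{S}\to S$ there is a subset $P'\subseteq\overline{\Omega}_A\mathsf{S}$ such that $\varphi(P')=P$ and $p_{\mathsf{V}}(P')$ is a singleton (respectively a singleton consisting of an idempotent). $\mathsf{V}$ is $\sigma$-reducible for the pointlike (respectively idempotent pointlike) problem if, for every finite semigroup $S$,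 every $\mathsf{V}$-pointlike (respectively $\mathsf{V}$-idempotent pointlike) subset $P$ of $S$ and every such $\varphi$, the set $P'$ can be chosen to be a subset of $\Omega^\sigma_A\mathsf{S}$. *)

(* Defs.v *)
From HB Require Import structures.
From mathcomp Require Import all_boot all_classical topology zify.

Set Implicit Arguments.
Unset Strict Implicit.
Unset Printing Implicit Defensive.

Local Open Scope classical_set_scope.
Local Open Scope group_scope.

#[short(type="finSemigroupType")]
HB.structure Definition FinSemigroup := {S of Finite S & Semigroup S}.

HB.instance Definition _ (S T : finSemigroupType) := Semigroup.on (S * T)%type.

Fact unit_mulA : associative (fun _ _ : unit => tt). Proof. by []. Qed.
HB.instance Definition _ := isSemigroup.Build unit unit_mulA.

(** [spow x n] is x^(n+1), since a semigroup has no zeroth power *)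
Definition spow (S : semigroupType) (x : S) (n : nat) : S := iter n (mul x) x.

Lemma spowD (S : semigroupType) (x : S) m n :
  spow x m * spow x n = spow x (m + n).+1.
Proof. by elim: m => [|m IHm] //; rewrite addSn /= -mulgA IHm. Qed.

Lemma spowM (S : semigroupType) (x : S) m n :
  spow (spow x m) n = spow x (m.+1 * n.+1).-1.
Proof.
elim: n => [|n IHn]; first by rewrite muln1.
by rewrite {1}/spow iterS -/(spow _ n) IHn spowD; congr spow; lia.
Qed.

Lemma spow_idem (S : semigroupType) (x : S) n : x * x = x -> spow x n = x.
Proof. by move=> xx; elim: n => //= n ->. Qed.

Lemma spow_morph (S T : semigroupType) (f : {multiplicative S -> T}) x n :
  f (spow x n) = spow (f x) n.
Proof. by elim: n => //= n IHn; rewrite gmulfM IHn. Qed.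

(** The exponent #|S|! is at least the index and a multiple of the period of
    every element, see [omega_pow_idem] and [omega_pow_uniq]. *)
Definition omega_pow (S : finSemigroupType) (x : S) : S := spow x (#|S|)`!.-1.

Lemma omega_pow_idem (S : finSemigroupType) (x : S) :
  omega_pow x * omega_pow x = omega_pow x.
Proof.
pose g (i : 'I_#|S|.+1) := spow x i.
have /injectivePn[i0 [j0 ne_ij eq_g]] : ~~ injectiveb g.
  apply/negP => /injectiveP /leq_card; by rewrite card_ord ltnn.
have [i [j [lt_ij le_j e]]] :
    exists i j : nat, [/\ i < j, j <= #|S| & spow x i = spow x j].
  case: (ltngtP i0 j0) => [lt|lt|/ord_inj eq].
  - by exists i0, j0; split=> //; rewrite -ltnS.
  - by exists j0, i0; split=> //; rewrite -ltnS.
  - by rewrite eq eqxx in ne_ij.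
have per1 k : i <= k -> spow x (k + (j - i)) = spow x k.
  rewrite leq_eqVlt => /predU1P[<-|lt_ik]; first by rewrite subnKC // ltnW.
  have -> : spow x k = spow x i * spow x (k - i).-1 by rewrite spowD; congr spow; lia.
  by rewrite e spowD; congr spow; lia.
have per k m : i <= k -> spow x (k + m * (j - i)) = spow x k.
  move=> le_ik; elim: m => [|m IHm]; first by rewrite addn0.
  have -> : (k + m.+1 * (j - i) = k + m * (j - i) + (j - i))%N by lia.
  by rewrite per1 //; lia.
have /dvdnP[q Eq] : (j - i) %| (#|S|)`!.
  by apply: dvdn_fact; lia.
have leN : #|S| <= (#|S|)`! := fact_geq _.
have N0 : 0 < (#|S|)`! := fact_gt0 _.
rewrite /omega_pow spowD.
have -> : ((#|S|)`!.-1 + (#|S|)`!.-1).+1 = ((#|S|)`!.-1 + q * (j - i))%N.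
  by rewrite -Eq; lia.
by rewrite per //; lia.
Qed.

Lemma omega_pow_uniq (S : finSemigroupType) (x : S) n :
  spow x n * spow x n = spow x n -> spow x n = omega_pow x.
Proof.
move=> xn; rewrite -(spow_idem (#|S|)`!.-1 xn).
by rewrite -(spow_idem n (omega_pow_idem x)) /omega_pow !spowM mulnC.
Qed.

Lemma omega_pow_morph (S T : finSemigroupType) (f : {multiplicative S -> T}) x :
  f (omega_pow x) = omega_pow (f x).
Proof.
rewrite {1}/omega_pow spow_morph; apply: omega_pow_uniq.
by rewrite -spow_morph -gmulfM omega_pow_idem.
Qed.

Definition regular (S : semigroupType) (x : S) := exists y : S, x * y * x = x.

Definition idempotent_elt (S : semigroupType) (x : S) := x * x = x.

(** The empty semigroup is allowed, so that the free objects on the empty set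
    are empty. *)
Record pseudovariety := Pseudovariety {
  pv_mem :> finSemigroupType -> Prop ;
  pv_sub : forall (S T : finSemigroupType) (f : {multiplicative S -> T}),
    injective f -> pv_mem T -> pv_mem S ;
  pv_quo : forall (S T : finSemigroupType) (f : {multiplicative S -> T}),
    range f = [set: T] -> pv_mem S -> pv_mem T ;
  pv_unit : pv_mem unit ;
  pv_prod : forall S T : finSemigroupType,
    pv_mem S -> pv_mem T -> pv_mem (S * T)%type
}.

Definition pvS : pseudovariety :=
  @Pseudovariety (fun _ => True) (fun _ _ _ _ _ => I) (fun _ _ _ _ _ => I) I
    (fun _ _ _ _ => I).

Definition in_DA (S : finSemigroupType) :=
  forall x : S, regular x -> idempotent_elt x.

Lemma in_DA_sub (S T : finSemigroupType) (f : {multiplicative S -> T}) :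
  injective f -> in_DA T -> in_DA S.
Proof.
move=> injf DT x [y xyx]; apply: injf; rewrite gmulfM; apply: DT.
by exists (f y); rewrite -!gmulfM xyx.
Qed.

Lemma in_DA_quo (S T : finSemigroupType) (f : {multiplicative S -> T}) :
  range f = [set: T] -> in_DA S -> in_DA T.
Proof.
move=> surjf DS t [u tut].
have [s _ fs] : range f t by rewrite surjf.
have [r _ fr] : range f u by rewrite surjf.
pose e := omega_pow (s * r).
have fe : f e = t * u.
  rewrite omega_pow_morph gmulfM fs fr -[LHS]/(spow _ _) spow_idem //.
  by rewrite mulgA tut.
have [n en] : exists n, e * e = s * r * spow (s * r) n.
  by exists ((#|S|)`!.-1 + (#|S|)`!.-1)%N; rewrite /e /omega_pow spowD.
have <- : f (e * s) = t by rewrite gmulfM fe fs.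
rewrite /idempotent_elt -gmulfM; congr (f _); apply: DS.
exists (r * spow (s * r) n).
have -> : e * s * (r * spow (s * r) n) = e * (s * r * spow (s * r) n).
  by rewrite !mulgA.
by rewrite -en omega_pow_idem mulgA !omega_pow_idem.
Qed.

Lemma in_DA_unit : in_DA unit. Proof. by case. Qed.

Lemma in_DA_prod (S T : finSemigroupType) :
  in_DA S -> in_DA T -> in_DA (S * T)%type.
Proof.
move=> DS DT [x1 x2] [[y1 y2] [e1 e2]].
by congr pair; [apply: DS; exists y1|apply: DT; exists y2].
Qed.

Definition DA : pseudovariety :=
  Pseudovariety in_DA_sub in_DA_quo in_DA_unit in_DA_prod.

(** The finite semigroups with carrier 'I_n: every finite semigroup is
    isomorphic to one of these. Quantifying over them rather than over
    [finSemigroupType] keeps the limits below in the universe of [finType]. *)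
Record ordSemigroup := OrdSemigroup {
  os_card : nat ;
  os_mul : 'I_os_card -> 'I_os_card -> 'I_os_card ;
  os_mulA : associative os_mul
}.

Definition os_sort (s : ordSemigroup) : Type := 'I_(os_card s).
Coercion os_sort : ordSemigroup >-> Sortclass.
HB.instance Definition _ (s : ordSemigroup) := Finite.copy (os_sort s) 'I_(os_card s).
HB.instance Definition _ (s : ordSemigroup) :=
  isSemigroup.Build (os_sort s) (@os_mulA s).

Section OrdOf.
Variable S : finSemigroupType.

Fact ord_of_mulA : associative (fun x y : 'I_#|S| =>
  enum_rank (enum_val x * enum_val y)).
Proof. by move=> x y z; rewrite !enum_rankK mulgA. Qed.

Definition ord_of : ordSemigroup := OrdSemigroup ord_of_mulA.

Definition of_ord (x : ord_of) : S := enum_val x.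
Definition to_ord (x : S) : ord_of := enum_rank x.

Lemma to_ordK : cancel to_ord of_ord. Proof. exact: enum_rankK. Qed.
Lemma of_ordK : cancel of_ord to_ord. Proof. exact: enum_valK. Qed.

Fact of_ord_morph : {morph of_ord : x y / x * y}.
Proof. by move=> x y; exact: enum_rankK. Qed.
HB.instance Definition _ := isMultiplicative.Build ord_of S of_ord of_ord_morph.

Fact to_ord_morph : {morph to_ord : x y / x * y}.
Proof.
move=> x y; apply: (can_inj of_ordK).
by rewrite of_ord_morph !to_ordK.
Qed.
HB.instance Definition _ := isMultiplicative.Build S ord_of to_ord to_ord_morph.

Lemma ord_of_mem (V : pseudovariety) : V S -> V ord_of.
Proof. refine (@pv_sub V ord_of S of_ord (can_inj of_ordK)). Qed.

End OrdOf.

Record marked (V : pseudovariety) (A : finType) := Marked {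
  mk_sg :> ordSemigroup ;
  mk_mem : V mk_sg ;
  mk_gen : A -> mk_sg
}.

(** An A-ary implicit operation on V is a family of maps S^A -> S, for S in V,
    commuting with homomorphisms. It is given here by its values at all pairs
    (S, A -> S); this is the limit of the A-marked semigroups of V. *)
Definition implicit_ops (V : pseudovariety) (A : finType) :
    set (prod_topology (fun i : marked V A => discrete_topology i)) :=
  [set p | forall (i j : marked V A) (f : {multiplicative i -> j}),
     (forall a, f (mk_gen i a) = mk_gen j a) -> f (p i) = p j].

Definition Omega (V : pseudovariety) (A : finType) : Type :=
  set_type (@implicit_ops V A).
HB.instance Definition _ V A := Topological.on (Omega V A).

Section OmegaSemigroup.
Variables (V : pseudovariety) (A : finType).
Implicit Types u v w : Omega V A.

Definition mk_Omega p (Pp : @implicit_ops V A p) : Omega V A := SigSub (mem_set Pp).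

Definition Omega_eval u (i : marked V A) : i := \val u i.

Lemma Omega_evalP u (i j : marked V A) (f : {multiplicative i -> j}) :
  (forall a, f (mk_gen i a) = mk_gen j a) -> f (Omega_eval u i) = Omega_eval u j.
Proof. exact: (set_mem (valP u)). Qed.

Lemma Omega_ext u v : (forall i, Omega_eval u i = Omega_eval v i) -> u = v.
Proof. by move=> uv; apply: val_inj; apply: functional_extensionality_dep. Qed.

Fact Omega_mul_subproof u v :
  @implicit_ops V A (fun i => Omega_eval u i * Omega_eval v i).
Proof. by move=> i j f fij; rewrite gmulfM !(Omega_evalP _ fij). Qed.

Definition Omega_mul u v := mk_Omega (Omega_mul_subproof u v).

Fact Omega_mulA : associative Omega_mul.
Proof. by move=> u v w; apply: Omega_ext => i; apply: mulgA. Qed.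

HB.instance Definition _ := isSemigroup.Build (Omega V A) Omega_mulA.

Fact Omega_gen_subproof a : @implicit_ops V A (fun i => mk_gen i a).
Proof. by move=> i j f; apply. Qed.

Definition Omega_gen a : Omega V A := mk_Omega (Omega_gen_subproof a).

End OmegaSemigroup.

Inductive gen_by (A : Type) (S : magmaType) (h : A -> S) : set S :=
| gen_by_base a : gen_by h (h a)
| gen_by_mul x y : gen_by h x -> gen_by h y -> gen_by h (x * y).

Section SubSg.
Variables (S : finSemigroupType) (P : set S).
Definition subsg of (forall x y, P x -> P y -> P (x * y)) : Type :=
  {x : S | `[< P x >]}.
Hypothesis PM : forall x y, P x -> P y -> P (x * y).
HB.instance Definition _ := Finite.on (subsg PM).
HB.instance Definition _ := SubType.on (subsg PM).
Fact subsg_closed (x y : subsg PM) : `[< P (val x * val y) >].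
Proof. by apply/asboolP; apply: PM; apply/asboolP; [exact: (valP x)|exact: (valP y)]. Qed.
Definition subsg_mul (x y : subsg PM) : subsg PM := Sub (val x * val y) (subsg_closed x y).
Fact subsg_mulA : associative subsg_mul.
Proof. by move=> x y z; apply: val_inj; apply: mulgA. Qed.
HB.instance Definition _ := isSemigroup.Build (subsg PM) subsg_mulA.
Definition subsg_val (x : subsg PM) : S := val x.
Fact subsg_valM : {morph subsg_val : x y / x * y}. Proof. by []. Qed.
HB.instance Definition _ := isMultiplicative.Build (subsg PM) S subsg_val subsg_valM.
Lemma subsg_mem (V : pseudovariety) : V S -> V (subsg PM).
Proof. exact: (@pv_sub V (subsg PM) S subsg_val val_inj). Qed.
End SubSg.

(** [Omega V A] is a compact, Hausdorff, zero-dimensional topological semigroup,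
    in which the subsemigroup generated by [A] is dense; every map from [A] to a
    member [S] of [V] extends to a continuous homomorphism [Omega_lift], which
    is unique by [Omega_morph_ext]. So it is the free pro-V semigroup on [A]. *)
Section Free.
Variables (V : pseudovariety) (A : finType).

Definition mk_of (S : finSemigroupType) (VS : V S) (h : A -> S) : marked V A :=
  @Marked V A (ord_of S) (ord_of_mem VS) (fun a => to_ord (h a)).

Definition Omega_lift (S : finSemigroupType) (VS : V S) (h : A -> S) (u : Omega V A) : S :=
  of_ord (Omega_eval u (mk_of VS h)).

Fact Omega_lift_morph S VS h : {morph @Omega_lift S VS h : u v / u * v}.
Proof. by move=> u v; rewrite /Omega_lift -gmulfM. Qed.
HB.instance Definition _ (S : finSemigroupType) VS h :=
  isMultiplicative.Build (Omega V A) S (@Omega_lift S VS h) (@Omega_lift_morph S VS h).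

Lemma Omega_lift_gen (S : finSemigroupType) VS h a : @Omega_lift S VS h (Omega_gen V a) = h a.
Proof. by rewrite /Omega_lift /=; exact: to_ordK. Qed.

Lemma eval_continuous (i : marked V A) :
  continuous ((@Omega_eval V A)^~ i : Omega V A -> discrete_topology i).
Proof.
move=> u; apply: (@continuous_comp (Omega V A) _ _ (\val) (fun p => p i)).
  exact: initial_continuous.
exact: (@proj_continuous {classic (marked V A)}
  (fun i => discrete_topology i)).
Qed.

Lemma Omega_lift_continuous (S : finSemigroupType) VS h :
  continuous (@Omega_lift S VS h : Omega V A -> discrete_topology S).
Proof.
move=> u; apply: (@continuous_comp (Omega V A)
  (discrete_topology (mk_of VS h)) (discrete_topology S)
  ((@Omega_eval V A)^~ (mk_of VS h)) (@of_ord S)).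
  exact: eval_continuous.
by move=> B /principal_filterP nB; apply/principal_filterP.
Qed.

Lemma Omega_lift_eval (S : finSemigroupType) VS h (i : marked V A)
    (f : {multiplicative S -> i}) (u : Omega V A) :
  (forall a, f (h a) = mk_gen i a) -> f (@Omega_lift S VS h u) = Omega_eval u i.
Proof.
move=> fh; apply: (@Omega_evalP V A u (mk_of VS h) i (f \o @of_ord S)) => a /=.
by rewrite to_ordK.
Qed.

Lemma Omega_directed (i j : marked V A) : exists k : marked V A,
  forall u v : Omega V A, Omega_eval u k = Omega_eval v k ->
    Omega_eval u i = Omega_eval v i /\ Omega_eval u j = Omega_eval v j.
Proof.
pose h a := (mk_gen i a, mk_gen j a).
have Vij : V (i * j)%type := pv_prod (mk_mem i) (mk_mem j).
exists (mk_of Vij h) => u v e.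
have e' : Omega_lift Vij h u = Omega_lift Vij h v by rewrite /Omega_lift e.
rewrite -(@Omega_lift_eval _ Vij h i fst) // -(@Omega_lift_eval _ Vij h i fst) // e'.
by rewrite -(@Omega_lift_eval _ Vij h j snd) // -(@Omega_lift_eval _ Vij h j snd) // e'.
Qed.

Lemma nbhs_Omega (u : Omega V A) (B : set (Omega V A)) :
  nbhs u B <-> exists i, forall v, Omega_eval v i = Omega_eval u i -> B v.
Proof.
split; last first.
  move=> [i iB]; apply: filterS iB _.
  exact: (@eval_continuous i u [set x | x = Omega_eval u i]
            (discrete_set1 (Omega_eval u i : discrete_topology i))).
pose F : set_system (prod_topology (fun i : marked V A => discrete_topology i)) :=
  [set C | exists i, forall v : Omega V A,
                 Omega_eval v i = Omega_eval u i -> C (\val v)].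
have FF : Filter F.
  split.
  - by exists (mk_of (pv_unit V) (fun=> tt)).
  - move=> C D [i iC] [j jD]; have [k kP] := Omega_directed i j; exists k => v /kP[? ?].
    by split; [exact: iC|exact: jD].
  - by move=> C D CD [i iC]; exists i => v /iC /CD.
have Fu : F --> \val u.
  apply/cvg_sup => i C [_ [[D oD <-] Dui] DC]; exists i => v vi.
  by apply: DC; move: Dui; rewrite /preimage /= -/(Omega_eval u i) -vi.
move=> [_ [[C oC <-] Cu] CB].
have [i iC] : F C by apply: Fu; apply: open_nbhs_nbhs.
by exists i => v /iC /CB.
Qed.

Lemma words_dense (u : Omega V A) : closure (gen_by (@Omega_gen V A)) u.
Proof.
move=> B /nbhs_Omega[i iB].
have PM := @gen_by_mul _ _ (mk_gen i).
pose T := subsg PM; have VT : V T := subsg_mem PM (mk_mem i).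
pose h a : T := Sub (mk_gen i a) (asboolT (gen_by_base (mk_gen i) a)).
have: gen_by (mk_gen i) (Omega_eval u i).
  rewrite -(@Omega_lift_eval _ VT h i (@subsg_val _ _ PM)) //; apply/asboolP.
  exact: (valP (Omega_lift VT h u)).
suff gen_lift x : gen_by (mk_gen i) x -> exists2 v, gen_by (@Omega_gen V A) v
    & Omega_eval v i = x.
  by move=> /gen_lift[v gv vi]; exists v; split=> //; apply: iB.
elim=> [a|_ _ _ [v gv <-] _ [w gw <-]].
  by exists (Omega_gen V a); first exact: gen_by_base.
by exists (v * w); first exact: gen_by_mul.
Qed.

Lemma Omega_morph_ext (T : topologicalType) (mT : T -> T -> T) (f g : Omega V A -> T) :
  hausdorff_space T -> continuous f -> continuous g ->
  {morph f : u v / u * v >-> mT u v} -> {morph g : u v / u * v >-> mT u v} ->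
  (forall a, f (Omega_gen V a) = g (Omega_gen V a)) -> f = g.
Proof.
move=> hT cf cg fM gM fg; apply/funext => u.
have fgw w : gen_by (@Omega_gen V A) w -> f w = g w.
  by elim=> // x y _ ex _ ey; rewrite fM gM ex ey.
apply: hT => B C nB nC.
have nBC : nbhs u ((f @^-1` B) `&` (g @^-1` C)).
  by apply: filterI; [exact: cf|exact: cg].
have [w [gw [Bw Cw]]] := words_dense nBC.
by exists (f w); split=> //; rewrite fgw.
Qed.

Lemma Omega_compact : compact [set: Omega V A].
Proof.
rewrite compact_ultra => F FU _.
have ex_lim (i : marked V A) : exists x, F [set u | Omega_eval u i = x].
  apply: contrapT => /forallNP nF.
  have Fn x : F [set u | Omega_eval u i <> x].
    by have [/nF|] := in_ultra_setVsetC [set u : Omega V A | Omega_eval u i = x] FU.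
  have [u /(_ (Omega_eval u i))] := filter_ex (filter_forall _ Fn).
  exact.
pose p (i : marked V A) : i := projT1 (cid (ex_lim i)).
have pP i : F [set u | Omega_eval u i = p i] := projT2 (cid (ex_lim i)).
have Pp : @implicit_ops V A p.
  move=> i j f fij.
  have [u [<- <-]] := filter_ex (filterI (pP i) (pP j)).
  exact: Omega_evalP.
exists (mk_Omega Pp); split=> // B /nbhs_Omega[i iB].
by apply: filterS (pP i) => v /iB.
Qed.

Lemma Omega_hausdorff : hausdorff_space (Omega V A).
Proof.
move=> u v uv; apply: Omega_ext => i.
have nB w : nbhs w [set w' : Omega V A | Omega_eval w' i = Omega_eval w i].
  by apply/nbhs_Omega; exists i.
by have [w [<- <-]] := uv _ _ (nB u) (nB v).
Qed.

Lemma Omega_zero_dimensional : zero_dimensional (Omega V A).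
Proof.
move=> u v /eqP uv.
have [i ne] : exists i, Omega_eval u i <> Omega_eval v i.
  by apply/existsNP => e; apply/uv/Omega_ext.
pose D := [set x : discrete_topology i | x = Omega_eval u i].
exists (((@Omega_eval V A)^~ i : _ -> discrete_topology i) @^-1` D); split=> //=.
  apply: preimage_clopen; last exact: eval_continuous.
  by split; [exact: discrete_open|exact: discrete_closed].
by move=> e; apply: ne; rewrite e.
Qed.

Lemma Omega_mul_continuous :
  continuous (fun uv : Omega V A * Omega V A => uv.1 * uv.2).
Proof.
move=> [u v] B /nbhs_Omega[i iB].
exists ([set w | Omega_eval w i = Omega_eval u i],
        [set w | Omega_eval w i = Omega_eval v i]) => /=.
  by split; apply/nbhs_Omega; exists i.
by move=> [w1 w2] [/= e1 e2]; apply: iB; rewrite /Omega_eval/= -/(Omega_eval w1 i) -/(Omega_eval w2 i) e1 e2.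
Qed.
End Free.

(** The canonical projection from the free profinite semigroup. *)
Definition to_pvS V A (i : marked V A) : marked pvS A :=
  @Marked pvS A i I (@mk_gen V A i).

Fact Omega_proj_subproof V A (u : Omega pvS A) :
  @implicit_ops V A (fun i => Omega_eval u (to_pvS i)).
Proof.
by move=> i j f fij; apply: (@Omega_evalP pvS A u (to_pvS i) (to_pvS j)).
Qed.

Definition Omega_proj V A (u : Omega pvS A) : Omega V A :=
  mk_Omega (@Omega_proj_subproof V A u).

Fact Omega_proj_morph V A : {morph @Omega_proj V A : u v / u * v}.
Proof. by move=> u v; apply: Omega_ext. Qed.
HB.instance Definition _ V A :=
  isMultiplicative.Build (Omega pvS A) (Omega V A) (@Omega_proj V A)
    (@Omega_proj_morph V A).

Lemma Omega_proj_continuous V A : continuous (@Omega_proj V A).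
Proof.
move=> u B /nbhs_Omega[i iB]; apply/nbhs_Omega.
by exists (to_pvS i) => v e; apply: iB.
Qed.

Lemma Omega_proj_gen V A a : Omega_proj V (Omega_gen pvS a) = Omega_gen V a :> Omega V A.
Proof. exact: Omega_ext. Qed.

Definition subst_mark V A n (u : 'I_n -> Omega V A) (i : marked V A) :
    marked pvS 'I_n :=
  @Marked pvS 'I_n i I (fun k => Omega_eval (u k) i).

(** The natural interpretation in [Omega V A] of an n-ary pseudoword [w]. *)
Fact interp_subproof V A n (w : Omega pvS 'I_n) (u : 'I_n -> Omega V A) :
  @implicit_ops V A (fun i => Omega_eval w (subst_mark u i)).
Proof.
move=> i j f fij.
apply: (@Omega_evalP pvS 'I_n w (subst_mark u i) (subst_mark u j)) => k /=.
exact: Omega_evalP.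
Qed.

Definition interp V A n (w : Omega pvS 'I_n) (u : 'I_n -> Omega V A) : Omega V A :=
  mk_Omega (interp_subproof w u).

(** By these lemmas and [Omega_morph_ext], [interp ^~ u] is the unique continuous
    homomorphism sending the k-th generator to [u k], which is how a pseudoword
    acts on a profinite semigroup. *)
Section Interp.
Variables (V : pseudovariety) (A : finType) (n : nat) (u : 'I_n -> Omega V A).

Lemma interp_continuous : continuous (fun w => interp w u).
Proof.
move=> w B /nbhs_Omega[i iB]; apply/nbhs_Omega.
by exists (subst_mark u i) => w' e; apply: iB.
Qed.

Lemma interp_morph : {morph (fun w => interp w u) : v w / v * w}.
Proof. by move=> v w; apply: Omega_ext. Qed.

Lemma interp_gen k : interp (Omega_gen pvS k) u = u k.
Proof. exact: Omega_ext. Qed.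
End Interp.

Definition mul_pseudoword : Omega pvS 'I_2 :=
  Omega_gen pvS ord0 * Omega_gen pvS ord_max.

Fact omega_pseudoword_subproof :
  @implicit_ops pvS 'I_1 (fun i => omega_pow (mk_gen i ord0)).
Proof. by move=> i j f fij; rewrite omega_pow_morph fij. Qed.

Definition omega_pseudoword : Omega pvS 'I_1 := mk_Omega omega_pseudoword_subproof.

Record implicit_signature := ImplicitSignature {
  sig_ops :> forall n, set (Omega pvS 'I_n) ;
  sig_mul : sig_ops mul_pseudoword
}.

Inductive omega_ops : forall n, set (Omega pvS 'I_n) :=
| omega_ops_mul : omega_ops mul_pseudoword
| omega_ops_pow : omega_ops omega_pseudoword.

Definition omega_sig : implicit_signature := ImplicitSignature omega_ops_mul.

(** The sigma-subalgebra of the free profinite semigroup generated by [A]. *)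
Inductive Omega_sig (sigma : implicit_signature) (A : finType) : set (Omega pvS A) :=
| Omega_sig_gen a : Omega_sig sigma (Omega_gen pvS a)
| Omega_sig_op n (w : Omega pvS 'I_n) (u : 'I_n -> Omega pvS A) :
    sigma n w -> (forall k, Omega_sig sigma (u k)) -> Omega_sig sigma (interp w u).

Definition onto_continuous (A : finType) (S : finSemigroupType)
    (phi : {multiplicative Omega pvS A -> S}) :=
  continuous (phi : Omega pvS A -> discrete_topology S) /\ range phi = [set: S].

Definition singleton (T : Type) (B : set T) := exists v, B = [set v].

Definition idempotent_singleton (T : semigroupType) (B : set T) :=
  exists2 v : T, B = [set v] & idempotent_elt v.

Section Pointlike.
Variable V : pseudovariety.

Definition pointlike (S : finSemigroupType) (P : set S) :=
  P !=set0 /\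
  forall (A : finType) (phi : {multiplicative Omega pvS A -> S}),
    onto_continuous phi ->
  exists P' : set (Omega pvS A),
    phi @` P' = P /\ singleton (@Omega_proj V A @` P').

Definition idempotent_pointlike (S : finSemigroupType) (P : set S) :=
  P !=set0 /\
  forall (A : finType) (phi : {multiplicative Omega pvS A -> S}),
    onto_continuous phi ->
  exists P' : set (Omega pvS A),
    phi @` P' = P /\ idempotent_singleton (@Omega_proj V A @` P').

Definition pointlike_reducible (sigma : implicit_signature) :=
  forall (S : finSemigroupType) (P : set S), pointlike P ->
  forall (A : finType) (phi : {multiplicative Omega pvS A -> S}),
    onto_continuous phi ->
  exists P' : set (Omega pvS A),
    [/\ P' `<=` Omega_sig sigma (A := A), phi @` P' = P &
        singleton (@Omega_proj V A @` P')].

Definition idempotent_pointlike_reducible (sigma : implicit_signature) :=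
  forall (S : finSemigroupType) (P : set S), idempotent_pointlike P ->
  forall (A : finType) (phi : {multiplicative Omega pvS A -> S}),
    onto_continuous phi ->
  exists P' : set (Omega pvS A),
    [/\ P' `<=` Omega_sig sigma (A := A), phi @` P' = P &
        idempotent_singleton (@Omega_proj V A @` P')].

End Pointlike.

(* Main.v *)
From HB Require Import structures.
From mathcomp Require Import all_boot all_classical topology zify.
Require Import Defs.

(** For each n, words are compared by a finite invariant [profile n]: the letters
    [a] occurring in the word, together with the profiles of level n - 1 of the
    factors before and after the first and the last occurrence of each [a].
    Equality of profiles is a congruence with quotient in DA, so a DA-pointlike
    set is, for every n, the image of a family of words with equal n-profiles.
    For large n such a family is turned into a family of ω-terms with the same
    images and a common value over DA, by induction on the alphabet B of the
    words. From all words, cut off at the same places, on both sides, up to K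
    blocks, each of them a shortest prefix or suffix of alphabet B. If fewer than
    K blocks exist, all pieces have a smaller alphabet or are single letters. If
    there are K of them, two products of initial blocks on the left have the same
    images (a family of images is one of finitely many tuples), so that a factor
    y^ω, and similarly z^ω on the right, can be inserted without changing the
    images; since y^ω w z^ω = y^ω z^ω over DA as soon as the letters of [w] occur
    in both [y] and [z], what is left in the middle does not matter over DA. In
    this second case the value over DA is idempotent, and the second case is
    forced if the words are equivalent to their powers. *)

Set Implicit Arguments.
Unset Strict Implicit.
Unset Printing Implicit Defensive.

Local Open Scope classical_set_scope.
Local Open Scope group_scope.

(** * Profiles of words *)

Section Profiles.
Variable A : finType.
Implicit Types (a : A) (u v w x y z : seq A).

Definition before_first a w := take (index a w) w.
Definition after_first a w := drop (index a w).+1 w.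
(** Defined by reversal, so that facts on last occurrences follow from facts on first occurrences
    through [profile_rev]. *)
Definition before_last a w := rev (after_first a (rev w)).
Definition after_last a w := rev (before_first a (rev w)).

Lemma before_first_cat a x y : a \notin x -> before_first a (x ++ a :: y) = x.
Proof. by move=> ax; rewrite /before_first index_cat (negPf ax) /= eqxx addn0 take_size_cat. Qed.

Lemma after_first_cat a x y : a \notin x -> after_first a (x ++ a :: y) = y.
Proof.
by move=> ax; rewrite /after_first index_cat (negPf ax) /= eqxx addn0 -cat_rcons
  drop_size_cat // size_rcons.
Qed.

Lemma split_first a w : a \in w -> exists x y, w = x ++ a :: y /\ a \notin x.
Proof.
elim: w => // b w IHw; rewrite inE; case: eqVneq => [->|ab] /= => [_|/IHw[x [y [-> ax]]]].
  by exists [::], w.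
by exists (b :: x), y; rewrite inE negb_or ab ax.
Qed.

(** Finiteness of each level makes the quotient of words a finite semigroup. [None] marks an absent
    letter, so level 1 already determines the alphabet. *)
Fixpoint profile_type n : finType :=
  if n is m.+1 then
    {ffun A -> option ((profile_type m * profile_type m) *
                       (profile_type m * profile_type m))}
  else unit.

Fixpoint profile n w : profile_type n :=
  match n with
  | 0 => tt
  | m.+1 => [ffun a =>
      if a \in w then
        Some ((profile m (before_first a w), profile m (after_first a w)),
              (profile m (before_last a w), profile m (after_last a w)))
      else None]
  end.

Lemma profile_recE n w : profile n.+1 w = [ffun a =>
  if a \in w then
    Some ((profile n (before_first a w), profile n (after_first a w)),
          (profile n (before_last a w), profile n (after_last a w)))
  else None].
Proof. by []. Qed.

Lemma profileS n u v :
  profile n.+1 u = profile n.+1 v <->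
  u =i v /\ forall a, a \in u ->
    [/\ profile n (before_first a u) = profile n (before_first a v),
        profile n (after_first a u) = profile n (after_first a v),
        profile n (before_last a u) = profile n (before_last a v) &
        profile n (after_last a u) = profile n (after_last a v)].
Proof.
rewrite !profile_recE; split=> [/ffunP e|[uv e]]; last first.
  apply/ffunP => a; rewrite !ffunE -uv; case: ifP => // au.
  by have [-> -> -> ->] := e a au.
split=> [a|a au]; move: (e a); rewrite !ffunE; first by do 2![case: ifP => _].
by rewrite au; case: ifP => // _ [].
Qed.

Lemma profile_rev n u v :
  profile n u = profile n v -> profile n (rev u) = profile n (rev v).
Proof.
elim: n u v => // n IHn u v /profileS[uv e]; apply/profileS.
split=> [a|a]; first by rewrite !mem_rev.
rewrite mem_rev => /e[e1 e2 e3 e4].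
split; last 2 first.
- by rewrite /before_last !revK; apply: IHn.
- by rewrite /after_last !revK; apply: IHn.
- by rewrite -[LHS]/(profile n _) -[before_first _ _]revK -[before_first _ (rev v)]revK; apply: IHn.
- by rewrite -[after_first _ _]revK -[after_first _ (rev v)]revK; apply: IHn.
Qed.

Lemma profile_leq m n u v :
  m <= n -> profile n u = profile n v -> profile m u = profile m v.
Proof.
elim: n m u v => [|n IHn] [|m] // u v le_mn /profileS[uv e]; apply/profileS; split=> // a /e.
by case=> *; split; apply: IHn.
Qed.

Lemma profile_mem n u v : profile n.+1 u = profile n.+1 v -> u =i v.
Proof. by case/profileS. Qed.

Lemma before_first_catl a u v : a \in u -> before_first a (u ++ v) = before_first a u.
Proof.
by move=> /split_first[x [y [-> ax]]]; rewrite -catA !before_first_cat.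
Qed.

Lemma after_first_catl a u v : a \in u -> after_first a (u ++ v) = after_first a u ++ v.
Proof.
by move=> /split_first[x [y [-> ax]]]; rewrite -catA !after_first_cat.
Qed.

Lemma before_first_catr a u v :
  a \notin u -> a \in v -> before_first a (u ++ v) = u ++ before_first a v.
Proof.
move=> au /split_first[x [y [-> ax]]]; rewrite catA !before_first_cat //.
by rewrite mem_cat negb_or au.
Qed.

Lemma after_first_catr a u v :
  a \notin u -> a \in v -> after_first a (u ++ v) = after_first a v.
Proof.
move=> au /split_first[x [y [-> ax]]]; rewrite catA !after_first_cat //.
by rewrite mem_cat negb_or au.
Qed.

(** The alphabet of [u] decides whether the first [a] falls in [u] or in [v]. The parts around it
    come from that factor, one of them extended by the other factor, and the induction hypothesis
    compares them. *)
Lemma profile_cat n u v u' v' :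
  profile n u = profile n u' -> profile n v = profile n v' ->
  profile n (u ++ v) = profile n (u' ++ v').
Proof.
elim: n u v u' v' => // n IHn.
have half u v u' v' a : profile n.+1 u = profile n.+1 u' ->
    profile n.+1 v = profile n.+1 v' -> a \in u ++ v ->
    profile n (before_first a (u ++ v)) = profile n (before_first a (u' ++ v')) /\
    profile n (after_first a (u ++ v)) = profile n (after_first a (u' ++ v')).
  move=> eu ev; have [/profileS[muu pu] /profileS[mv pv]] := (eu, ev).
  have [e1 e2] := (profile_leq (leqnSn n) eu, profile_leq (leqnSn n) ev).
  rewrite mem_cat; case: (boolP (a \in u)) => [au _|au /= av].
    have au' : a \in u' by rewrite -muu.
    rewrite !before_first_catl // !after_first_catl //.
    by have [p1 p2 _ _] := pu _ au; split=> //; apply: IHn.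
  have au' : a \notin u' by rewrite -muu.
  have av' : a \in v' by rewrite -mv.
  rewrite !before_first_catr // !after_first_catr //.
  by have [p1 p2 _ _] := pv _ av; split=> //; apply: IHn.
move=> u v u' v' eu ev; apply/profileS; split=> [a|a auv].
  by rewrite !mem_cat (profile_mem eu) (profile_mem ev).
have [-> ->] := half _ _ _ _ _ eu ev auv.
have avu : a \in rev v ++ rev u by rewrite mem_cat !mem_rev orbC -mem_cat.
have [e1 e2] := half _ _ _ _ _ (profile_rev ev) (profile_rev eu) avu.
by split=> //; rewrite /before_last /after_last !rev_cat; apply: profile_rev.
Qed.

(** * Powers of words and the behaviour of DA on profiles *)

Definition wpow w n : seq A := flatten (nseq n w).

Lemma wpowS w n : wpow w n.+1 = w ++ wpow w n. Proof. by []. Qed.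

Lemma wpowD w m n : wpow w (m + n) = wpow w m ++ wpow w n.
Proof. by rewrite /wpow nseqD flatten_cat. Qed.

Lemma wpowSr w n : wpow w n.+1 = wpow w n ++ w.
Proof. by rewrite -addn1 wpowD /wpow /= cats0. Qed.

Lemma mem_wpow a w n : a \in wpow w n -> a \in w.
Proof. by elim: n => // n IHn; rewrite wpowS mem_cat => /orP[]. Qed.

Lemma rev_wpow w n : rev (wpow w n) = wpow (rev w) n.
Proof. by elim: n => // n IHn; rewrite wpowS wpowSr rev_cat IHn. Qed.

(** The pseudoidentity p^ω z q^ω = p^ω z' q^ω of DA, at the level of profiles. *)
Lemma profile_absorb n p q z z' :
  p =i q -> {subset z <= p} -> {subset z' <= p} ->
  profile n (wpow p n ++ z ++ wpow q n) = profile n (wpow p n ++ z' ++ wpow q n).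
Proof.
elim: n p q z z' => // n IHn.
have half p q z z' a : p =i q -> {subset z <= p} -> {subset z' <= p} -> a \in p ->
    profile n (before_first a (wpow p n.+1 ++ z ++ wpow q n.+1)) =
      profile n (before_first a (wpow p n.+1 ++ z' ++ wpow q n.+1)) /\
    profile n (after_first a (wpow p n.+1 ++ z ++ wpow q n.+1)) =
      profile n (after_first a (wpow p n.+1 ++ z' ++ wpow q n.+1)).
  move=> pq zp zp' ap; rewrite wpowS -!catA !before_first_catl // !after_first_catl //.
  (* The first [a] lies in the first [p]. After it, n copies of [p] remain, and one copy of [q] is
     moved into the middle word to leave n copies of [q] too. *)
  split=> //; apply: profile_cat => //; rewrite wpowS !(catA _ q).
  by apply: IHn => // b; rewrite mem_cat -pq => /orP[|//]; [apply: zp|apply: zp'].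
have mem p q z a : p =i q -> {subset z <= p} ->
    (a \in wpow p n.+1 ++ z ++ wpow q n.+1) = (a \in p).
  move=> pq zp; rewrite !wpowS !mem_cat; case: (boolP (a \in p)) => //= ap.
  apply/negP => /or3P[/mem_wpow|/zp|/orP[|/mem_wpow]]; rewrite -?pq; exact/negP.
move=> p q z z' pq zp zp'; apply/profileS; split=> [a|a].
  by rewrite !mem.
rewrite mem // => ap; have [-> ->] := half _ _ _ _ _ pq zp zp' ap.
have qp' : rev q =i rev p by move=> b; rewrite !mem_rev.
have rz t : {subset t <= p} -> {subset rev t <= rev q}.
  by move=> tp b; rewrite !mem_rev -pq; apply: tp.
have aq : a \in rev q by rewrite mem_rev -pq.
have [e1 e2] := half _ _ _ _ _ qp' (rz _ zp) (rz _ zp') aq.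
have revE t : rev (wpow p n.+1 ++ t ++ wpow q n.+1) =
    wpow (rev q) n.+1 ++ rev t ++ wpow (rev p) n.+1.
  by rewrite rev_cat (rev_cat t) -catA !rev_wpow.
by split; rewrite // /before_last /after_last !revE; apply: profile_rev.
Qed.

Lemma profile_wpowl n u x m :
  profile n u = profile n (x ++ u) -> profile n u = profile n (wpow x m ++ u).
Proof.
move=> e; elim: m => // m IHm; rewrite IHm wpowSr -catA.
exact: profile_cat.
Qed.

Lemma profile_wpowr n u y m :
  profile n u = profile n (u ++ y) -> profile n u = profile n (u ++ wpow y m).
Proof.
move=> e; elim: m => [|m IHm]; first by rewrite cats0.
by rewrite IHm wpowS catA; apply: profile_cat.
Qed.

(** From u ≡ uvu follow u ≡ (uv)^n u and u ≡ u(vu)^n, so uu ≡ (uv)^n uu (vu)^n, where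
    [profile_absorb] shrinks the middle uu to u. *)
Lemma profile_regular n u v :
  profile n u = profile n (u ++ v ++ u) -> profile n (u ++ u) = profile n u.
Proof.
move=> e; have el := e; rewrite catA in el.
have {}el := profile_wpowl n el; have {}e := profile_wpowr n e.
rewrite (profile_cat el e) -catA (catA u).
rewrite [RHS](_ : _ = profile n (wpow (u ++ v) n ++ u ++ wpow (v ++ u) n)).
  apply: profile_absorb => a; rewrite !mem_cat; first by rewrite orbC.
    by rewrite orbb => ->.
  by move=> ->.
by rewrite el; apply: profile_cat.
Qed.

Lemma profile_wpow n u m : profile n (u ++ u) = profile n u ->
  profile n (wpow u m.+1) = profile n u.
Proof. by move=> e; rewrite wpowSr -profile_wpowl. Qed.

(** * Alphabets of words *)

Definition alphabet w : {set A} := [set a in w]%SET.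

Lemma mem_alphabet a w : (a \in alphabet w) = (a \in w).
Proof. by rewrite inE. Qed.

Lemma alphabet_nil : alphabet [::] = finset.set0.
Proof. by apply/setP => a; rewrite !inE. Qed.

Lemma alphabet_cons a w : alphabet (a :: w) = (a |: alphabet w)%SET.
Proof. exact: finset.set_cons. Qed.

Lemma alphabet_cat u w : alphabet (u ++ w) = (alphabet u :|: alphabet w)%SET.
Proof. by apply/setP => a; rewrite !inE mem_cat. Qed.

Lemma alphabet_rev w : alphabet (rev w) = alphabet w.
Proof. by apply/setP => a; rewrite !inE mem_rev. Qed.

Lemma profile_alphabet n u v : 0 < n -> profile n u = profile n v -> alphabet u = alphabet v.
Proof. by case: n => // n _ /profile_mem uv; apply/setP => a; rewrite !inE uv. Qed.

(** The letter [a] is the one whose first occurrence comes last, so [x ++ [:: a]] is the shortest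
    prefix with the full alphabet. *)
Lemma last_new_letter w : w != [::] ->
  exists a x y, [/\ w = x ++ a :: y, a \notin x & alphabet x = (alphabet w :\ a)%SET].
Proof.
elim/last_ind: w => // w b IHw _; case: (boolP (b \in w)) => bw.
  have /IHw[a [x [y [e ax xw]]]] : w != [::] by case: w bw {IHw}.
  exists a, x, (rcons y b); rewrite {1}e rcons_cat rcons_cons; split=> //.
  rewrite xw; apply/setP => c; rewrite !inE mem_rcons inE.
  by case: (c =P b) => [->|//]; rewrite bw.
exists b, w, [::]; rewrite cats1; split=> //; apply/setP => c.
rewrite !inE mem_rcons inE; case: eqP => //= ->; exact/negbTE.
Qed.

(** * Cutting a family of words at a common letter *)

Section Peel.
Variables (I : finType) (i0 : I).

Definition alike n (w : I -> seq A) := forall k, profile n (w k) = profile n (w i0).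

Lemma alike_leq m n (w : I -> seq A) : m <= n -> alike n w -> alike m w.
Proof. by move=> le_mn ww k; apply: profile_leq (ww k). Qed.

Lemma alike_alphabet n (w : I -> seq A) k : alike n.+1 w -> alphabet (w k) = alphabet (w i0).
Proof. by move=> ww; apply: profile_alphabet (ww k). Qed.

(** The letter is chosen for [w i0]; equal profiles make it cut every [w k] into matching pieces, at
    the cost of one level. The level left is positive, so the alphabets of the pieces agree. *)
Lemma peel_first n (w : I -> seq A) : alike n.+2 w -> alphabet (w i0) != finset.set0 ->
  exists a (x y : I -> seq A), [/\ forall k, w k = x k ++ a :: y k,
    a \in alphabet (w i0) /\ a \notin x i0,
    forall k, alphabet (x k) = (alphabet (w i0) :\ a)%SET,
    alike n.+1 x & alike n.+1 y].
Proof.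
move=> ww w0; have /last_new_letter[a [x [y [e ax xw]]]] : w i0 != [::].
  by apply: contraNneq w0 => ->; rewrite alphabet_nil.
have aw : a \in w i0 by rewrite e mem_cat inE eqxx orbT.
have awk k : a \in w k by rewrite (profile_mem (ww k)).
have xE : x = before_first a (w i0) by rewrite e before_first_cat.
have parts k : profile n.+1 (before_first a (w k)) = profile n.+1 (before_first a (w i0)) /\
    profile n.+1 (after_first a (w k)) = profile n.+1 (after_first a (w i0)).
  by case/profileS: (ww k) => _ /(_ a (awk k))[].
exists a, (fun k => before_first a (w k)), (fun k => after_first a (w k)).
split=> [k||k|k|k]; try by case: (parts k).
- by have [x' [y' [-> ax']]] := split_first (awk k); rewrite before_first_cat // after_first_cat.
- by rewrite -xE mem_alphabet.
- by rewrite -xw xE; apply: profile_alphabet (parts k).1.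
Qed.

Lemma peel_last n (w : I -> seq A) : alike n.+2 w -> alphabet (w i0) != finset.set0 ->
  exists a (x y : I -> seq A), [/\ forall k, w k = x k ++ a :: y k,
    a \in alphabet (w i0) /\ a \notin y i0,
    forall k, alphabet (y k) = (alphabet (w i0) :\ a)%SET,
    alike n.+1 x & alike n.+1 y].
Proof.
move=> ww w0; have := @peel_first n (fun k => rev (w k)).
case=> [k||a [x [y [e [aw ax] xw xx yy]]]]; first exact: profile_rev.
  by rewrite alphabet_rev.
exists a, (fun k => rev (y k)), (fun k => rev (x k)).
split=> [k||k|k|k]; try exact: profile_rev.
- by rewrite -[LHS]revK e rev_cat rev_cons cat_rcons.
- by rewrite -alphabet_rev mem_rev.
- by rewrite alphabet_rev xw alphabet_rev.
Qed.

End Peel.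

(** * The finite quotient of words by equality of profiles *)

Section ProfileSemigroup.
Variable n : nat.

Definition profile_sg : Type := {p : profile_type n | `[< exists w, profile n w = p >]}.
HB.instance Definition _ := Finite.on profile_sg.
HB.instance Definition _ := SubType.on profile_sg.

Fact profile_sgP w : `[< exists u, profile n u = profile n w >].
Proof. by apply/asboolP; exists w. Qed.

Definition profile_class w : profile_sg := Sub (profile n w) (profile_sgP w).

Definition profile_repr (p : profile_sg) : seq A := projT1 (cid (asboolW (valP p))).

Lemma profile_class_eq u v : profile_class u = profile_class v <-> profile n u = profile n v.
Proof. by split=> [/(congr1 val)//|e]; apply: val_inj. Qed.

Lemma profile_reprK : cancel profile_repr profile_class.
Proof. by move=> p; apply: val_inj; rewrite /= /profile_repr; case: cid. Qed.

Definition profile_mul (p q : profile_sg) := profile_class (profile_repr p ++ profile_repr q).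

Lemma profile_mulE u v : profile_mul (profile_class u) (profile_class v) = profile_class (u ++ v).
Proof.
by apply/profile_class_eq/profile_cat; apply/profile_class_eq; rewrite profile_reprK.
Qed.

Fact profile_mulA : associative profile_mul.
Proof.
move=> p q r; rewrite -(profile_reprK p) -(profile_reprK q) -(profile_reprK r).
by rewrite !profile_mulE catA.
Qed.
HB.instance Definition _ := isSemigroup.Build profile_sg profile_mulA.

Lemma profile_class_cat u v :
  profile_class (u ++ v) = profile_class u * profile_class v.
Proof. by rewrite -profile_mulE. Qed.

Lemma profile_sg_DA : in_DA profile_sg.
Proof.
move=> p [q]; rewrite /idempotent_elt -[p]profile_reprK -[q]profile_reprK.
move: (profile_repr p) (profile_repr q) => u v.
rewrite -(profile_class_cat u v) -(profile_class_cat (u ++ v)) -(profile_class_cat u u).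
move=> /profile_class_eq/esym; rewrite -catA => e.
by apply/profile_class_eq; apply: profile_regular e.
Qed.

End ProfileSemigroup.
End Profiles.

(** * The free pro-DA semigroup *)

Section AdjoinUnit.
Variable S : semigroupType.

(** [None] is an adjoined unit, which serves as the value of the empty word. *)
Definition omul (x y : option S) : option S :=
  match x, y with
  | Some a, Some b => Some (a * b)
  | Some _, None => x
  | None, _ => y
  end.

Fact omulA : associative omul.
Proof. by case=> [x|] [y|] [z|] //=; rewrite mulgA. Qed.
Fact omul1o : left_id None omul. Proof. by case. Qed.
Fact omulo1 : right_id None omul. Proof. by case. Qed.
HB.instance Definition _ := isMonoid.Build (option S) omulA omul1o omulo1.

End AdjoinUnit.

Lemma omap_mul (S T : semigroupType) (f : {multiplicative S -> T}) x y :
  omap f (x * y) = omap f x * omap f y.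
Proof. by case: x y => [x|] [y|] //; congr Some; apply: gmulfM. Qed.

(** * Absorption when regular elements are idempotent *)

Section RegularIdempotent.
Variable S : semigroupType.
Hypothesis regular_idem : forall x : S, regular x -> idempotent_elt x.
Implicit Types a b e f w x y : S.

(** With r = e x a and s = y e, e = r s and r is regular, hence idempotent, which gives r e = e.
    Then [a * e] is regular, hence idempotent, and e = (e x)(a e) absorbs a further [a * e]. *)
Lemma absorb_factor e x a y : e * e = e -> e = x * a * y -> e * a * e = e.
Proof.
move=> ee exay; pose r := e * x * a; pose s := y * e.
have rs : r * s = e by rewrite /r /s mulgA -(mulgA e) -(mulgA e) -exay !ee.
have er : e * r = r by rewrite /r !mulgA ee.
have rr : r * r = r.
  by apply: regular_idem; exists s; rewrite rs er.
have re : r * e = e by rewrite -[in LHS]rs mulgA rr rs.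
have aeae : a * e * (a * e) = a * e.
  apply: regular_idem; exists (e * x).
  have -> : a * e * (e * x) * (a * e) = a * (e * e * x * a * e) by rewrite !mulgA.
  by rewrite ee -/r re.
have exae : e * x * (a * e) = e by rewrite mulgA.
by rewrite -mulgA -[X in X * _]exae -mulgA aeae exae.
Qed.

(** The element [b * e * a] is regular through [e], hence idempotent, and e (a b) e equals e (b e
    a)(b e a) e. *)
Lemma absorb_mul e a b : e * e = e -> e * a * e = e -> e * b * e = e -> e * (a * b) * e = e.
Proof.
move=> ee eae ebe.
have beabea : b * e * a * (b * e * a) = b * e * a.
  apply: regular_idem; exists e.
  have -> : b * e * a * e * (b * e * a) = b * (e * a * e) * b * e * a by rewrite !mulgA.
  by rewrite eae -!mulgA (mulgA e b) (mulgA (e * b)) ebe.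
have -> : e * (a * b) * e = (e * b * e) * a * b * (e * a * e) by rewrite eae ebe !mulgA.
have -> : e * b * e * a * b * (e * a * e) = e * (b * e * a * (b * e * a)) * e by rewrite !mulgA.
by rewrite beabea !mulgA ebe eae.
Qed.

Lemma absorb_between e f w : e * e = e -> f * f = f ->
  e * f * e = e -> f * e * f = f -> e * w * e = e -> f * w * f = f ->
  e * w * f = e * f.
Proof.
move=> ee ff efe fef ewe fwf.
have h : e * (w * f) * e = e by apply: absorb_mul.
by rewrite -[in LHS]fef !mulgA -(mulgA e w f) h.
Qed.

End RegularIdempotent.

Lemma spowSr (S : semigroupType) (x : S) n : spow x n * x = spow x n.+1.
Proof. by rewrite -[LHS]/(spow x n * spow x 0) spowD addn0. Qed.

(** This is the aperiodicity of DA: [x * e] is regular, hence idempotent, and multiplying by a power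
    [y] with y x = e cancels one factor. *)
Lemma omega_pow_mulr (S : finSemigroupType) (x : S) : in_DA S -> x * omega_pow x = omega_pow x.
Proof.
move=> DAS; have := omega_pow_idem x; rewrite /omega_pow; case: (_.-1) => // n.
set e := spow x n.+1 => ee; pose y := spow x n.
have xe : x * e = e * x by rewrite /e spowSr.
have yx : y * x = e by rewrite /y spowSr.
clearbody e y.
have xey : x * e * y * (x * e) = x * e.
  by rewrite mulgA -(mulgA _ y) yx -!mulgA ee ee.
have : x * e * (x * e) = x * e by apply: DAS; exists y.
move=> /(congr1 (mul y)); by rewrite !mulgA yx ee -xe -mulgA ee.
Qed.

Section OmegaPower.
Variables (V : pseudovariety) (A : finType).
Implicit Types u v : Omega V A.

Definition opow u : Omega V A := interp omega_pseudoword (fun=> u).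

Lemma opow_eval u i : Omega_eval (opow u) i = omega_pow (Omega_eval u i).
Proof. by []. Qed.

Lemma opow_lift (S : finSemigroupType) (VS : V S) (h : A -> S) u :
  Omega_lift VS h (opow u) = omega_pow (Omega_lift VS h u).
Proof. by rewrite /Omega_lift opow_eval omega_pow_morph. Qed.

Lemma opow_idem u : opow u * opow u = opow u.
Proof. by apply: Omega_ext => i; apply: omega_pow_idem. Qed.

End OmegaPower.

Lemma opow_proj V (A : finType) (u : Omega pvS A) : Omega_proj V (opow u) = opow (Omega_proj V u).
Proof. exact: Omega_ext. Qed.

Section OmegaTerms.
Variable A : finType.
Implicit Types u v : Omega pvS A.

Lemma Omega_sig_opow u : Omega_sig omega_sig u -> Omega_sig omega_sig (opow u).
Proof. by move=> su; apply: Omega_sig_op => //; apply: omega_ops_pow. Qed.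

Lemma Omega_sig_mul u v :
  Omega_sig omega_sig u -> Omega_sig omega_sig v -> Omega_sig omega_sig (u * v).
Proof.
move=> su sv; pose w (k : 'I_2) := if k == ord0 then u else v.
have -> : u * v = interp mul_pseudoword w by apply: Omega_ext.
by apply: Omega_sig_op => [|k]; [apply: omega_ops_mul|rewrite /w; case: ifP].
Qed.

(** It serves to show that a continuous [phi] commutes with ω-powers, as lifts do. *)
Lemma Omega_lift_unique (S : finSemigroupType) (phi : {multiplicative Omega pvS A -> S}) :
  continuous (phi : Omega pvS A -> discrete_topology S) ->
  phi = @Omega_lift pvS A S I (phi \o @Omega_gen pvS A) :> (Omega pvS A -> S).
Proof.
move=> phic.
apply: (@Omega_morph_ext pvS A (discrete_topology S) (@mul S)) => //.
- exact: discrete_hausdorff.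
- exact: Omega_lift_continuous.
- exact: gmulfM.
- exact: gmulfM.
- by move=> a; rewrite Omega_lift_gen.
Qed.

End OmegaTerms.

Section FreeDA.
Variable A : finType.
Implicit Types (u v e f : Omega DA A).

Lemma Omega_DA_regular u : regular u -> idempotent_elt u.
Proof.
move=> [v uvu]; apply: Omega_ext => i; apply: (mk_mem i); exists (Omega_eval v i).
by rewrite -[LHS]/(Omega_eval (u * v * u) i) uvu.
Qed.

Lemma opow_mulr u : u * opow u = opow u.
Proof. by apply: Omega_ext => i; apply: omega_pow_mulr; apply: (mk_mem i). Qed.

Lemma absorb_opow e u : e * e = e -> e * u * e = e -> e * opow u * e = e.
Proof.
move=> /(congr1 (@Omega_eval _ _)) ee /(congr1 (@Omega_eval _ _)) eue.
apply: Omega_ext => i.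
have {}ee : Omega_eval e i * Omega_eval e i = Omega_eval e i.
  exact: (congr1 (fun F => F i) ee).
have {}eue : Omega_eval e i * Omega_eval u i * Omega_eval e i = Omega_eval e i.
  exact: (congr1 (fun F => F i) eue).
rewrite -[LHS]/(Omega_eval e i * omega_pow (Omega_eval u i) * Omega_eval e i).
rewrite /omega_pow; elim: (_.-1) => //= n IHn.
by apply: absorb_mul => //; apply: (mk_mem i).
Qed.

End FreeDA.

Lemma option_regular_idem (S : semigroupType) :
  (forall x : S, regular x -> idempotent_elt x) ->
  forall x : option S, regular x -> idempotent_elt x.
Proof.
move=> DAS [x|] // [[y|]] [xyx]; congr Some; apply: DAS; first by exists y.
by exists x; rewrite !xyx.
Qed.

Notation oopow := (omap (@opow _ _)).
Notation oomega_pow := (omap (@omega_pow _)).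

(** * Letters of ω-terms and absorption in the free pro-DA monoid *)

Section Content.
Variable A : finType.
Implicit Types (B C : {set A}) (u v e f w : option (Omega DA A)) (a : A).

Definition letter a : option (Omega DA A) := Some (Omega_gen DA a).

(** The letters are read off an ω-term building the value, which makes induction over ω-terms
    available for elements of the free pro-DA monoid. *)
Inductive has_content : {set A} -> option (Omega DA A) -> Prop :=
| has_content1 : has_content finset.set0 1
| has_content_letter a : has_content [set a]%SET (letter a)
| has_content_mul B C u v :
    has_content B u -> has_content C v -> has_content (B :|: C)%SET (u * v)
| has_content_opow B u : has_content B u -> has_content B (oopow u).

Lemma oopow_idem u : oopow u * oopow u = oopow u.
Proof. by case: u => // u; congr Some; apply: opow_idem. Qed.

Lemma oopow_mulr u : u * oopow u = oopow u.
Proof. by case: u => // u; congr Some; apply: opow_mulr. Qed.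

Lemma has_content_factor B v a :
  has_content B v -> a \in B -> exists x y, v = x * letter a * y.
Proof.
elim=> {B v} [|b|B C u v _ IHu _ IHv|B u _ IHu].
- by rewrite finset.in_set0.
- by rewrite finset.in_set1 => /eqP <-; exists 1, 1; rewrite mul1g mulg1.
- rewrite finset.in_setU => /orP[/IHu|/IHv] [x [y ->]].
    by exists x, (y * v); rewrite !mulgA.
  by exists (u * x), y; rewrite !mulgA.
- move=> /IHu[x [y e]]; exists x, (y * oopow u).
  (* Writing u u^ω for u^ω exposes a copy of [u], in which [a] occurs. *)
  by rewrite -[LHS]oopow_mulr {1}e !mulgA.
Qed.

(** The elements absorbed by [e] are closed under products and ω-powers, so the letters suffice. *)
Lemma has_content_absorb B e v : e * e = e ->
  (forall a, a \in B -> e * letter a * e = e) -> has_content B v -> e * v * e = e.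
Proof.
move=> ee + hv; elim: hv => {B v} [|a|B C u v _ IHu _ IHv|B u _ IHu] eae.
- by rewrite mulg1.
- by apply: eae; rewrite finset.in_set1.
- apply: absorb_mul => //; first exact/option_regular_idem/Omega_DA_regular.
    by apply: IHu => a aB; apply: eae; rewrite finset.in_setU aB.
  by apply: IHv => a aC; apply: eae; rewrite finset.in_setU aC orbT.
- move: ee (IHu eae); case: e {IHu eae} => [e|]; case: u => [u|] // [ee] [eue].
  by congr Some; apply: absorb_opow.
Qed.

Lemma oopow_absorb B C u w :
  has_content B u -> has_content C w -> C \subset B -> oopow u * w * oopow u = oopow u.
Proof.
move=> hu hw /fintype.subsetP CB; apply: has_content_absorb hw; first exact: oopow_idem.
move=> a /CB/(has_content_factor (has_content_opow hu))[x [y e]].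
apply: absorb_factor (oopow_idem _) e.
exact/option_regular_idem/Omega_DA_regular.
Qed.

(** Each letter of [B] is a factor of both ω-powers, so these absorb [w] and each other, as
    [absorb_between] requires. *)
Lemma oopow_absorb_between B C u v w :
  has_content B u -> has_content B v -> has_content C w -> C \subset B ->
  oopow u * w * oopow v = oopow u * oopow v.
Proof.
move=> hu hv hw CB; apply: absorb_between.
- exact/option_regular_idem/Omega_DA_regular.
- exact: oopow_idem.
- exact: oopow_idem.
- by apply: oopow_absorb hu (has_content_opow hv) _.
- by apply: oopow_absorb hv (has_content_opow hu) _.
- exact: oopow_absorb hu hw CB.
- exact: oopow_absorb hv hw CB.
Qed.

End Content.

(** * Families of ω-terms with prescribed images and a common value over DA *)

Section Realization.
Variables (A : finType) (S : finSemigroupType).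
Variable phi : {multiplicative Omega pvS A -> S}.
Hypothesis phi_opow : forall u, phi (opow u) = omega_pow (phi u).
Implicit Types (B C D : {set A}) (v : option (Omega DA A)) (w : seq A).

(** [over v x]: some ω-term (or the empty word) is mapped to [x] by [phi] and to
    [v] in the free pro-DA monoid. *)
Definition over v (x : option S) := exists u : option (Omega pvS A),
  [/\ omap phi u = x, forall u', u = Some u' -> Omega_sig omega_sig u' &
      omap (@Omega_proj DA A) u = v].

Definition word_image w : option S := \prod_(a <- w) Some (phi (Omega_gen pvS a)).
Definition word_DA w : option (Omega DA A) := \prod_(a <- w) letter a.

Lemma word_image_cat u w : word_image (u ++ w) = word_image u * word_image w.
Proof. exact: big_cat. Qed.

Lemma over1 : over 1 1. Proof. by exists 1. Qed.

Lemma over_letter a : over (letter a) (Some (phi (Omega_gen pvS a))).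
Proof.
exists (Some (Omega_gen pvS a)); split=> //= [u' [<-]|]; first exact: Omega_sig_gen.
by rewrite Omega_proj_gen.
Qed.

Lemma over_mul v v' x x' : over v x -> over v' x' -> over (v * v') (x * x').
Proof.
move=> [u [<- su <-]] [u' [<- su' <-]]; exists (u * u'); rewrite !omap_mul; split=> //.
case: u u' su su' => [u|] [u'|] su su' // _ [<-].
by apply: Omega_sig_mul; [apply: su|apply: su'].
Qed.

Lemma over_opow v x : over v x -> over (oopow v) (oomega_pow x).
Proof.
move=> [[u|] [<- su <-]]; last by exists 1.
exists (Some (opow u)); rewrite /= phi_opow opow_proj; split=> // _ [<-].
by apply: Omega_sig_opow; apply: su.
Qed.

Lemma over_word w : over (word_DA w) (word_image w).
Proof.
elim: w => [|a w IHw]; first by rewrite /word_DA /word_image !big_nil; apply: over1.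
by rewrite /word_DA /word_image !big_cons; apply: over_mul (over_letter a) IHw.
Qed.

Lemma has_content_word w : has_content (alphabet w) (word_DA w).
Proof.
elim: w => [|a w IHw].
  by rewrite alphabet_nil /word_DA big_nil; apply: has_content1.
rewrite alphabet_cons /word_DA big_cons.
exact: has_content_mul (has_content_letter a) IHw.
Qed.

Lemma oomega_pow_stabr (x y : option S) : x * y = x -> x * oomega_pow y = x.
Proof.
case: x y => [x|] [y|] // [xy]; congr Some; rewrite /omega_pow.
by elim: (_.-1) => //= n IHn; rewrite mulgA xy.
Qed.

Lemma oomega_pow_stabl (x y : option S) : y * x = x -> oomega_pow y * x = x.
Proof.
case: x y => [x|] [y|] // [yx]; congr Some; rewrite /omega_pow.
by elim: (_.-1) => //= n IHn; rewrite -mulgA IHn.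
Qed.

Section Families.
Variable I : finType.
Implicit Types x y p q : I -> option S.

(** One [v] serves all indices: the ω-terms for different [k] agree over DA. *)
Definition realized B x v := has_content B v /\ forall k, over v (x k).

Lemma realized_mul B C x y v v' : realized B x v -> realized C y v' ->
  realized (B :|: C)%SET (fun k => x k * y k) (v * v').
Proof.
move=> [hv ov] [hv' ov']; split; first exact: has_content_mul.
by move=> k; apply: over_mul.
Qed.

(** The ω-terms for the family are [vp vy^ω w vz^ω vq] with [w] depending on
    [k]; over DA the middle word [w] is absorbed. *)
Lemma realized_between B C D p y z q (m : I -> seq A) vp vy vz vq :
  C \subset B -> D \subset B ->
  realized C p vp -> realized B y vy -> realized B z vz -> realized D q vq ->
  (forall k, {subset m k <= B}) ->
  (forall k, p k * y k = p k) -> (forall k, z k * q k = q k) ->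
  exists2 v, realized B (fun k => p k * word_image (m k) * q k) v & v * v = v.
Proof.
move=> CB DB [hp op] [hy oy] [hz oz] [hq oq] mB py zq.
exists (vp * oopow vy * oopow vz * vq); last first.
  (* In the square, this product stands between vy^ω and vz^ω, so it is absorbed and one copy
     remains. *)
  have h : has_content (B :|: D :|: (C :|: B))%SET (oopow vz * vq * (vp * oopow vy)).
    by do !apply: has_content_mul => //; apply: has_content_opow.
  have hB : (B :|: D :|: (C :|: B))%SET \subset B by rewrite !finset.subUset subxx CB DB.
  have e := oopow_absorb_between hy hz h hB; rewrite !mulgA in e.
  have -> : vp * oopow vy * oopow vz * vq * (vp * oopow vy * oopow vz * vq) =
      vp * (oopow vy * oopow vz * vq * vp * oopow vy * oopow vz) * vq by rewrite !mulgA.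
  by rewrite e !mulgA.
split.
  have -> : B = (C :|: B :|: B :|: D)%SET.
    by rewrite (finset.setUidPr CB) finset.setUid (finset.setUidPl DB).
  by do !apply: has_content_mul => //; apply: has_content_opow.
move=> k.
have mk : alphabet (m k) \subset B by apply/fintype.subsetP => a; rewrite mem_alphabet; apply: mB.
(* On images the ω-powers are inserted by stabilisation; over DA the word [m k] is inserted by
   absorption. *)
rewrite -(oomega_pow_stabr (py k)) -(oomega_pow_stabl (zq k)) !mulgA.
rewrite -(mulgA vp) -(oopow_absorb_between hy hz (has_content_word (m k)) mk) !mulgA.
do !apply: over_mul => //; [exact: over_opow|exact: over_word|exact: over_opow].
Qed.

End Families.
End Realization.

(** * Words with equal profiles *)

Lemma pigeonhole_nat (T : finType) (f : nat -> T) :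
  exists i j : nat, [/\ i < j, j <= #|T| & f i = f j].
Proof.
have /injectivePn[i [j ne_ij eq_f]] : ~~ injectiveb (fun i : 'I_#|T|.+1 => f i).
  by apply/negP => /injectiveP /leq_card; rewrite card_ord ltnn.
case: (ltngtP i j) => [lt|lt|/ord_inj eq].
- by exists i, j; split=> //; rewrite -ltnS.
- by exists j, i; split=> //; rewrite -ltnS.
- by rewrite eq eqxx in ne_ij.
Qed.

(** * Words with many disjoint factors of full alphabet *)

Section Layers.
Variables (A : finType) (B : {set A}).
Implicit Types (u x y z m t : seq A).

(** A lower bound for the number of block pairs that greedy cutting from both ends must find. *)
Fixpoint layered K u : Prop :=
  if K is K'.+1 then
    exists y m z, [/\ u = y ++ m ++ z, B \subset alphabet y, B \subset alphabet z &
                      layered K' m]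
  else True.

Lemma layered_cat K x m y : layered K m -> layered K (x ++ m ++ y).
Proof.
case: K => // K [x' [m' [y' [-> Bx By lm]]]].
exists (x ++ x'), m', (y' ++ y); rewrite !alphabet_cat !catA; split=> //.
  exact: fintype.subset_trans Bx (finset.subsetUr _ _).
exact: fintype.subset_trans By (finset.subsetUl _ _).
Qed.

(** A prefix ending at the first [a] is no longer than any prefix containing [a], so removing it
    leaves [v] intact. *)
Lemma cat_first_cancel a x u y v :
  x ++ a :: u = y ++ v -> a \notin x -> a \in y -> exists t, u = t ++ v.
Proof.
move=> e ax /split_first[x' [t [ey ax']]]; exists t.
by rewrite -(after_first_cat u ax) e ey -catA after_first_cat.
Qed.

Lemma cat_last_cancel a y u x v :
  u ++ a :: y = v ++ x -> a \notin y -> a \in x -> exists t, u = v ++ t.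
Proof.
move=> /(congr1 rev); rewrite !rev_cat rev_cons cat_rcons => e ay ax.
have [||t /(congr1 rev)] := cat_first_cancel e; rewrite ?mem_rev //.
by rewrite rev_cat !revK => ->; exists (rev t).
Qed.

Lemma layered_peel_first K a x u : layered K.+1 (x ++ a :: u) -> a \in B -> a \notin x ->
  exists t z m, [/\ u = t ++ m ++ z, B \subset alphabet z & layered K m].
Proof.
move=> [y [m [z [e /fintype.subsetP By Bz lm]]]] /By; rewrite mem_alphabet => ay ax.
by have [t ->] := cat_first_cancel e ax ay; exists t, z, m.
Qed.

(** Both greedy cuts end within the outermost layer, so only that layer is lost. *)
Lemma layered_peel K a b x m y : layered K.+1 (x ++ a :: m ++ b :: y) ->
  a \in B -> b \in B -> a \notin x -> b \notin y -> layered K m.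
Proof.
move=> lw aB bB ax bY; have [t [z [m' [e /fintype.subsetP Bz lm]]]] := layered_peel_first lw aB ax.
have bz : b \in z by rewrite -mem_alphabet; apply: Bz.
rewrite catA in e; have [t' ->] := cat_last_cancel e bY bz.
by rewrite -catA; apply: layered_cat.
Qed.

End Layers.

Lemma layered_wpow (A : finType) K (u : seq A) : layered (alphabet u) K (wpow u K.*2).
Proof.
elim: K => // K IHK; exists u, (wpow u K.*2), u; split=> //.
by rewrite doubleS wpowS wpowSr.
Qed.

(** * From alike words to ω-terms, by induction on the alphabet *)

Section Reducibility.
Variables (A : finType) (S : finSemigroupType).
Variable phi : {multiplicative Omega pvS A -> S}.
Hypothesis phi_opow : forall u, phi (opow u) = omega_pow (phi u).
Variables (I : finType) (i0 : I).
Implicit Types (B C : {set A}) (w : I -> seq A) (f : {ffun I -> seq A}).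

Definition realizable B w :=
  exists v, realized phi B (fun k => word_image phi (w k)) v.

(** The pigeonhole bound: among the products of the first 0, ..., [tuple_count] blocks, two have the
    same images at all indices. *)
Definition tuple_count := #|{ffun I -> option S}|.

Lemma realizable_cat B C w w' : realizable B w -> realizable C w' ->
  realizable (B :|: C)%SET (fun k => w k ++ w' k).
Proof.
move=> [v rv] [v' rv']; exists (v * v').
have [hv ov] := realized_mul rv rv'; split=> // k.
by rewrite word_image_cat.
Qed.

Lemma realizable_const (u : seq A) : realizable (alphabet u) (fun=> u).
Proof. by exists (word_DA u); split=> [|_]; [apply: has_content_word|apply: over_word]. Qed.

Lemma realizable_ext B w w' : (forall k, w k = w' k) -> realizable B w -> realizable B w'.
Proof. by move=> ww' [v [hv ov]]; exists v; split=> // k; rewrite -ww'. Qed.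

Section Blocks.
Variable B : {set A}.

Definition block f := realizable B f /\ forall k, alphabet (f k) = B.

Definition cat_blocks (L : seq {ffun I -> seq A}) k := flatten [seq (f : {ffun _ -> _}) k | f <- L].

Lemma cat_blocks_cat L M k : cat_blocks (L ++ M) k = cat_blocks L k ++ cat_blocks M k.
Proof. by rewrite /cat_blocks map_cat flatten_cat. Qed.

(** The case distinction is forced by the empty product, which has no letters. *)
Lemma realizable_blocks L : (forall f, f \in L -> block f) ->
  realizable (if nilp L then finset.set0 else B) (cat_blocks L).
Proof.
elim: L => [|f L IHL] bL; first by rewrite -(@alphabet_nil A); apply: realizable_const.
have [rf _] := bL f (mem_head _ _).
have rL := IHL (fun g gL => bL g (mem_behead (s := f :: L) gL)).
rewrite /= [X in realizable X](_ : B = (B :|: if nilp L then finset.set0 else B)%SET).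
  exact: realizable_cat rf rL.
by case: ifP; rewrite ?finset.setU0 ?finset.setUid.
Qed.

Lemma blocks_alphabet L k : (forall f, f \in L -> block f) -> {subset cat_blocks L k <= B}.
Proof.
move=> bL a /flattenP[_ /mapP[f fL ->]]; have [_ fB] := bL f fL.
by rewrite -(fB k) mem_alphabet.
Qed.

(** Pigeonhole on prefixes of [L] and on suffixes of [R] yields block products [L2] and [R2] that
    stabilise the images of [take i L] and [drop j' R], as [realized_between] requires. *)
Lemma blocks_realizable w (m : I -> seq A) L R :
  tuple_count <= size L -> tuple_count <= size R ->
  (forall f, f \in L -> block f) -> (forall f, f \in R -> block f) ->
  (forall k, {subset m k <= B}) ->
  (forall k, w k = cat_blocks L k ++ m k ++ cat_blocks R k) ->
  exists2 v, realized phi B (fun k => word_image phi (w k)) v & v * v = v.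
Proof.
move=> sL sR bL bR mB wE.
pose im (M : seq _) : {ffun I -> option S} := [ffun k => word_image phi (cat_blocks M k)].
have [i [j [lt_ij le_jL eL]]] := pigeonhole_nat (fun j => im (take j L)).
have [i' [j' [lt_ij' le_jR eR]]] := pigeonhole_nat (fun j => im (drop j R)).
pose L2 := drop i (take j L); pose R2 := take (j' - i') (drop i' R).
have jL : take j L = take i L ++ L2.
  by rewrite -[LHS](cat_take_drop i) take_takel // ltnW.
have iR : drop i' R = R2 ++ drop j' R.
  by rewrite -[LHS](cat_take_drop (j' - i')) drop_drop subnK // ltnW.
have bL' (M : seq _) : {subset M <= L} -> forall f, f \in M -> block f by move=> s f /s/bL.
have bR' (M : seq _) : {subset M <= R} -> forall f, f \in M -> block f by move=> s f /s/bR.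
have sL2 : {subset L2 <= L} by move=> f /mem_drop/mem_take.
have sR2 : {subset R2 <= R} by move=> f /mem_take/mem_drop.
(* As i < j, the product to be raised to the ω-power is not empty and has content exactly [B]. *)
have L2n : nilp L2 = false.
  rewrite /nilp size_drop size_take_min; apply/negbTE.
  by rewrite subn_eq0 -ltnNge (minn_idPl _) // (leq_trans le_jL).
have R2n : nilp R2 = false.
  rewrite /nilp size_take_min size_drop; apply/negbTE.
  rewrite -lt0n leq_min !subn_gt0 lt_ij' /=.
  by rewrite (leq_trans lt_ij') // (leq_trans le_jR).
have [vp rp] := realizable_blocks (bL' (take i L) (@mem_take i _ L)).
have [vy ry] := realizable_blocks (bL' _ sL2).
have [vz rz] := realizable_blocks (bR' _ sR2).
have [vq rq] := realizable_blocks (bR' (drop j' R) (@mem_drop j' _ R)).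
rewrite L2n in ry; rewrite R2n in rz.
have sub0 (b : bool) : (if b then finset.set0 else B) \subset B.
  by case: b; rewrite ?finset.sub0set.
(* All blocks outside the repetitions join the middle word. *)
pose m' k := cat_blocks (drop j L) k ++ m k ++ cat_blocks (take i' R) k.
have m'B k : {subset m' k <= B}.
  move=> a; rewrite !mem_cat => /or3P[|/mB//|]; apply: blocks_alphabet.
    by apply: bL' => f /mem_drop.
  by apply: bR' => f /mem_take.
have eLk k : word_image phi (cat_blocks (take i L) k) = word_image phi (cat_blocks (take j L) k).
  by move/ffunP: eL => /(_ k); rewrite !ffunE.
have eRk k : word_image phi (cat_blocks (drop i' R) k) = word_image phi (cat_blocks (drop j' R) k).
  by move/ffunP: eR => /(_ k); rewrite !ffunE.
have [||v [hv ov] vv] := realized_between phi_opow (sub0 _) (sub0 _) rp ry rz rq m'B.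
- by move=> k; rewrite -word_image_cat -cat_blocks_cat -jL eLk.
- by move=> k; rewrite -word_image_cat -cat_blocks_cat -iR eRk.
exists v => //; split=> // k; move: (ov k).
(* The equal images allow passing from [take i L] to [take j L] and from [drop j' R] to [drop i' R],
   and the pieces recombine to [w k]. *)
rewrite eLk -eRk -!word_image_cat wE /m' -!catA -(cat_blocks_cat (take i' R)).
by rewrite cat_take_drop catA -cat_blocks_cat cat_take_drop.
Qed.

Variable n0 : nat.
Hypothesis realizable_proper : forall C w, C \proper B ->
  (forall k, alphabet (w k) = C) -> alike i0 n0 w -> realizable C w.
Hypothesis B_neq0 : B != finset.set0.

(** Each round cuts one block off either end and costs two levels. If a round fails, the remainder
    has a smaller alphabet, so every piece is realizable, and fewer than [K] layers were present. *)
Lemma peel_blocks K n w : n0 <= n.+1 -> alike i0 (K.*2 + n).+1 w ->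
  (forall k, {subset w k <= B}) ->
  (~ layered B K (w i0) /\ realizable (alphabet (w i0)) w) \/
  exists L m R, [/\ size L = K /\ size R = K, forall f, f \in L -> block f,
    forall f, f \in R -> block f, forall k, {subset m k <= B} &
    forall k, w k = cat_blocks L k ++ m k ++ cat_blocks R k].
Proof.
move=> le_n0; elim: K w => [|K IHK] w ww wB.
  by right; exists [::], w, [::]; split=> // k; rewrite cats0.
have subB k u : {subset u <= w k} -> alphabet u \subset B.
  by move=> uw; apply/fintype.subsetP => a; rewrite mem_alphabet => /uw/wB.
have proper_realizable w' : alphabet (w' i0) \subset B -> alphabet (w' i0) != B ->
    alike i0 n.+1 w' -> realizable (alphabet (w' i0)) w'.
  move=> sub ne ww'; apply: realizable_proper.
  - by rewrite finset.properEneq ne.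
  - by move=> k; apply: alike_alphabet ww'.
  - exact: alike_leq ww'.
have [wi0|wi0] := eqVneq (alphabet (w i0)) B; last first.
  have w0 : alphabet (w i0) \subset B by apply: (subB i0).
  left; split; last by apply: proper_realizable => //; apply: alike_leq ww; lia.
  move=> [y [m [z [e By _ _]]]]; move/negP: wi0; apply.
  rewrite finset.eqEsubset w0 (fintype.subset_trans By) //.
  by rewrite e alphabet_cat finset.subsetUl.
have w0 : alphabet (w i0) != finset.set0 by rewrite wi0.
have [a [x [y [e [aw ax] xw xx yy]]]] := peel_first (n := (K.*2 + n).+1) ww w0.
rewrite wi0 in aw xw.
have yB k : {subset y k <= B} by move=> b bY; apply: (wB k); rewrite e mem_cat inE bY !orbT.
have wE : w i0 = x i0 ++ a :: y i0 by [].
(* The part before [a] misses [a], so its alphabet is proper; the single letter restores [B]. *)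
have rx : realizable B (fun k => x k ++ [:: a]).
  have -> : B = (B :\ a :|: alphabet [:: a])%SET.
    by rewrite alphabet_cons alphabet_nil finset.setU0 finset.setUC finset.setD1K.
  apply: realizable_cat (realizable_const _).
  apply: realizable_proper => //; first exact: finset.properD1.
  by apply: alike_leq xx; lia.
have ysub : alphabet (y i0) \subset B.
  by apply/fintype.subsetP => b; rewrite mem_alphabet => /yB.
have [yi0|yi0] := eqVneq (alphabet (y i0)) B; last first.
  left; split.
    (* A layer would leave a right factor of full alphabet inside [y i0]. *)
    rewrite wE => /layered_peel_first-/(_ aw ax)[t [z [m [ey Bz _]]]].
    move/negP: yi0; apply; rewrite finset.eqEsubset ysub (fintype.subset_trans Bz) //.
    by rewrite ey !alphabet_cat finset.setUA finset.subsetUr.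
  have := realizable_cat rx (proper_realizable y ysub yi0 _).
  rewrite (finset.setUidPl ysub) wi0 => rxy.
  apply: (realizable_ext _ (rxy _)) => [k|]; first by rewrite e -catA.
  by apply: alike_leq yy; lia.
have y0 : alphabet (y i0) != finset.set0 by rewrite yi0.
have [b [m [z [ey [bw bz] zw mm zz]]]] := peel_last (n := (K.*2 + n)) yy y0.
rewrite yi0 in bw zw.
have mB k : {subset m k <= B} by move=> c cm; apply: (yB k); rewrite ey mem_cat cm.
have rz : realizable B (fun k => b :: z k).
  have -> : B = (alphabet [:: b] :|: (B :\ b))%SET.
    by rewrite alphabet_cons alphabet_nil finset.setU0 finset.setD1K.
  apply: realizable_cat (realizable_const [:: b]) _.
  apply: realizable_proper => //; first exact: finset.properD1.
  by apply: alike_leq zz; lia.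
have {}wE : w i0 = x i0 ++ a :: m i0 ++ b :: z i0 by rewrite e ey.
have [[nl rm]|[L [m' [R [[sL sR] bL bR m'B mE]]]]] := IHK m mm mB.
  left; split.
    by rewrite wE => /layered_peel-/(_ aw bw ax bz).
  have := realizable_cat (realizable_cat rx rm) rz.
  have msub : alphabet (m i0) \subset B.
    by apply/fintype.subsetP => c; rewrite mem_alphabet => /mB.
  rewrite (finset.setUidPl msub) finset.setUid wi0.
  by apply: realizable_ext => k; rewrite e ey -!catA.
right; exists ([ffun k => x k ++ [:: a]] :: L), m', (rcons R [ffun k => b :: z k]).
split=> //.
- by rewrite size_rcons /= sL sR.
- move=> f; rewrite inE => /orP[/eqP->|/bL//]; split=> [|k].
    by apply: realizable_ext rx => k; rewrite ffunE.
  rewrite ffunE alphabet_cat xw alphabet_cons alphabet_nil finset.setU0 finset.setUC.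
  by rewrite finset.setD1K.
- move=> f; rewrite mem_rcons inE => /orP[/eqP->|/bR//]; split=> [|k].
    by apply: realizable_ext rz => k; rewrite ffunE.
  by rewrite ffunE alphabet_cons zw finset.setD1K.
- move=> k; rewrite -cats1 cat_blocks_cat e ey mE /cat_blocks /= !ffunE cats0.
  by rewrite -!catA.
Qed.

Lemma realizable_layered n w : n0 <= n.+1 -> (forall k, alphabet (w k) = B) ->
  alike i0 (tuple_count.*2 + n).+1 w -> layered B tuple_count (w i0) ->
  exists2 v, realized phi B (fun k => word_image phi (w k)) v & v * v = v.
Proof.
move=> le_n0 wB ww lw.
have [|[/(_ lw)//]|[L [m [R [[sL sR] bL bR mB wE]]]]] := peel_blocks le_n0 ww.
  by move=> k a; rewrite -(wB k) mem_alphabet.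
by apply: blocks_realizable wE; rewrite ?sL ?sR.
Qed.

Lemma realizable_step n w : n0 <= n.+1 -> (forall k, alphabet (w k) = B) ->
  alike i0 (tuple_count.*2 + n).+1 w -> realizable B w.
Proof.
move=> le_n0 wB ww.
have [|[_]|[L [m [R [[sL sR] bL bR mB wE]]]]] := peel_blocks le_n0 ww.
- by move=> k a; rewrite -(wB k) mem_alphabet.
- by rewrite wB.
have [||v] := blocks_realizable _ _ bL bR mB wE; rewrite ?sL ?sR //.
by exists v.
Qed.

End Blocks.

(** Induction on the size of the alphabet; each further letter raises the level by the cost of
    [tuple_count] rounds of cutting. *)
Lemma alike_realizable_card m : exists n, forall B w, #|B| <= m ->
  (forall k, alphabet (w k) = B) -> alike i0 n w -> realizable B w.
Proof.
have real0 w : (forall k, alphabet (w k) = finset.set0) -> realizable finset.set0 w.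
  move=> w0; rewrite -(@alphabet_nil A); apply: realizable_ext (realizable_const [::]) => k.
  case: (w k) (w0 k) => // a u /setP/(_ a).
  by rewrite mem_alphabet inE eqxx finset.in_set0.
elim: m => [|m [n0 IHm]].
  exists 0 => B w; rewrite leqn0 cards_eq0 => /eqP-> w0 _; exact: real0.
exists (tuple_count.*2 + n0).+1 => B w cB wB ww.
have [B0|B_neq0] := eqVneq B finset.set0.
  by rewrite B0 in wB *; apply: real0.
apply: (realizable_step _ B_neq0 (leqnSn n0) wB ww) => C w' /fintype.proper_card ltCB.
by apply: IHm; rewrite -ltnS (leq_trans ltCB).
Qed.

Lemma alike_realizable : exists n, forall B w,
  (forall k, alphabet (w k) = B) -> alike i0 n w -> realizable B w.
Proof.
have [n nP] := alike_realizable_card #|A|; exists n => B w.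
exact: nP (max_card _).
Qed.

Lemma alike_realizable_idempotent : exists n, forall B w, B != finset.set0 ->
  (forall k, alphabet (w k) = B) -> alike i0 n w -> layered B tuple_count (w i0) ->
  exists2 v, realized phi B (fun k => word_image phi (w k)) v & v * v = v.
Proof.
have [n nP] := alike_realizable; exists (tuple_count.*2 + n).+1 => B w B_neq0 wB ww lw.
apply: (realizable_layered _ B_neq0 (leqnSn n) wB ww lw) => C w' _.
exact: nP.
Qed.

End Reducibility.

(** * Passing between pseudowords, words and ω-terms *)

Section WordApproximation.
Variables (A : finType) (S : finSemigroupType).
Variable phi : {multiplicative Omega pvS A -> S}.
Hypothesis phi_continuous : continuous (phi : Omega pvS A -> discrete_topology S).

Lemma phi_opow u : phi (opow u) = omega_pow (phi u).
Proof. by rewrite (Omega_lift_unique phi_continuous) opow_lift. Qed.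

(** Since the profile quotient lies in DA, the profile of a word extends to the free pro-DA
    semigroup. *)
Definition DA_profile n : Omega DA A -> profile_sg A n :=
  Omega_lift (@profile_sg_DA A n : DA (profile_sg A n)) (fun a => profile_class n [:: a]).

Lemma DA_profile_mul n u v : DA_profile n (u * v) = DA_profile n u * DA_profile n v.
Proof. exact: Omega_lift_morph. Qed.

(** Words are dense, and both [phi] and the profile are continuous into discrete spaces. *)
Lemma word_approximation n (u : Omega pvS A) : exists l : seq A,
  word_image phi l = Some (phi u) /\ profile_class n l = DA_profile n (Omega_proj DA u).
Proof.
pose k := to_pvS (mk_of (@profile_sg_DA A n : DA (profile_sg A n)) (fun a : A => profile_class n [:: a])).
have [|w [gw [wu wk]]] := @words_dense pvS A u
    [set w | phi w = phi u /\ Omega_eval w k = Omega_eval u k].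
  apply: filterI; last by apply/nbhs_Omega; exists k.
  exact: (phi_continuous (discrete_set1 (phi u : discrete_topology S))).
rewrite -wu; have -> : DA_profile n (Omega_proj DA u) = DA_profile n (Omega_proj DA w).
  by rewrite /DA_profile /Omega_lift; congr of_ord; symmetry; exact: wk.
elim: gw => {w wu wk} [a|x y _ [lx [ex px]] _ [ly [ey py]]].
  exists [:: a]; rewrite /word_image big_seq1 Omega_proj_gen; split=> //.
  by rewrite /DA_profile Omega_lift_gen.
exists (lx ++ ly); rewrite word_image_cat ex ey gmulfM; split=> //.
by rewrite gmulfM DA_profile_mul profile_class_cat px py.
Qed.

Variables (P : set S) (s0 : S).
Hypothesis Ps0 : P s0.

Lemma family_approximation n (P' : set (Omega pvS A)) v :
  phi @` P' = P -> @Omega_proj DA A @` P' = [set v] ->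
  exists w : S -> seq A, forall s, P s ->
    word_image phi (w s) = Some s /\ profile_class n (w s) = DA_profile n v.
Proof.
move=> phiP' projP'.
suff /choice[w wP] : forall s, exists l : seq A, P s ->
    word_image phi l = Some s /\ profile_class n l = DA_profile n v by exists w.
move=> s; have [|nPs] := pselect (P s); last by exists [::].
rewrite -phiP' => -[u P'u <-].
have [l [el pl]] := word_approximation n u; exists l => _; split=> //.
have : [set v] (Omega_proj DA u) by rewrite -projP'; exists u.
by move=> <-.
Qed.

(** All ω-terms of value [v] with image in [P] are taken; [s0] ensures that there is one. *)
Lemma omega_terms_of_over v : (forall s, P s -> over phi v (Some s)) ->
  exists P', [/\ P' `<=` Omega_sig omega_sig (A := A), phi @` P' = P &
    exists2 v', @Omega_proj DA A @` P' = [set v'] & Some v' = v].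
Proof.
move=> ov; exists [set t | [/\ Omega_sig omega_sig t, P (phi t) & Some (Omega_proj DA t) = v]].
have ovt s : P s -> exists t,
    [/\ Omega_sig omega_sig t, phi t = s & Some (Omega_proj DA t) = v].
  move=> /ov[] [t|] [] // [ts] st tv.
  by exists t; split=> //; apply: st.
split=> [t [] //||].
- apply/seteqP; split=> [_ [t [_ Pt _] <-]//|s Ps].
  by have [t [st ts tv]] := ovt s Ps; exists t => //; split=> //; rewrite ts.
- have [t0 [st0 ts0 tv0]] := ovt s0 Ps0.
  exists (Omega_proj DA t0) => //; apply/seteqP; split=> [_ [t [_ _ tv] <-]|_ ->].
    by apply: Some_inj; rewrite tv0.
  by exists t0 => //; split=> //; rewrite ts0.
Qed.

End WordApproximation.

Theorem corollary4p5 :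
  pointlike_reducible DA omega_sig /\ idempotent_pointlike_reducible DA omega_sig.
Proof.
split=> S P [[s0 Ps0] +] A phi onto => /(_ A phi onto) [P' [phiP']].
  move=> [v projP'].
  have phi_pow := phi_opow onto.1.
  have [n nP] := alike_realizable phi_pow s0.
  (* The extra level ensures that the profiles determine the alphabets. *)
  have [w wP] := family_approximation onto.1 n.+1 phiP' projP'.
  (* Indices outside [P] receive the word of [s0], so that the whole family is alike. *)
  pose w' s := if `[< P s >] then w s else w s0.
  have w's s : exists2 t, P t & w' s = w t.
    by rewrite /w'; case: asboolP => Pt; [exists s|exists s0].
  have ww : alike s0 n.+1 w'.
    move=> s; have [[t Pt ->] [t0 Pt0 ->]] := (w's s, w's s0).
    by apply/profile_class_eq; rewrite (wP t Pt).2 (wP t0 Pt0).2.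
  have w'B k : alphabet (w' k) = alphabet (w' s0) by apply: alike_alphabet ww.
  have [v' [_ ov]] := nP _ w' w'B (alike_leq (leqnSn n) ww).
  have ovP s : P s -> over phi v' (Some s).
    by move=> Ps; have := ov s; rewrite /w' (asboolT Ps) (wP s Ps).1.
  have [P'' [sP'' phiP'' [v'' projP'' _]]] := omega_terms_of_over Ps0 ovP.
  by exists P''; split=> //; exists v''.
move=> [v projP' vv].
have phi_pow := phi_opow onto.1.
(* The extra index [None] is the base point and carries a high power of [w s0], which supplies the
   layers. *)
have [n nP] := alike_realizable_idempotent phi_pow (None : option S).
have [w wP] := family_approximation onto.1 n.+1 phiP' projP'.
pose K := tuple_count S (option S).
pose w' (o : option S) :=
  if o is Some s then if `[< P s >] then w s else w s0 else wpow (w s0) K.*2.+1.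
have prof s : P s -> profile n.+1 (w s) = profile n.+1 (w s0).
  by move=> Ps; apply/profile_class_eq; rewrite (wP s Ps).2 (wP s0 Ps0).2.
(* Idempotency of [v] makes the profile of [w s0] idempotent, so its power is alike to the other
   words. *)
have idem : profile n.+1 (w s0 ++ w s0) = profile n.+1 (w s0).
  apply/profile_class_eq; rewrite profile_class_cat (wP s0 Ps0).2.
  by rewrite -DA_profile_mul vv.
have ww : alike None n.+1 w'.
  move=> o; rewrite [RHS]profile_wpow //; case: o => [s|]; last by rewrite profile_wpow.
  rewrite /w'.
  by case: asboolP => // /prof.
have wB : alphabet (w' None) = alphabet (w s0).
  by apply: profile_alphabet (ltn0Sn n) _; apply: profile_wpow.
have [||||v' [_ ov] v'v'] := nP (alphabet (w s0)) w'.
(* An empty alphabet would give [w s0] the adjoined unit as image, whereas its image is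
   [Some s0]. *)
- apply/eqP => ws0; have := (wP s0 Ps0).1; case: (w s0) ws0 => [_|a l /setP/(_ a)].
    by rewrite /word_image big_nil.
  by rewrite mem_alphabet inE eqxx finset.in_set0.
- by move=> o; rewrite -wB; apply: alike_alphabet ww.
- exact: alike_leq ww.
- have := layered_wpow K (w s0); move=> /(layered_cat (w s0) [::]).
  by rewrite cats0.
have ovP s : P s -> over phi v' (Some s).
  by move=> Ps; have := ov (Some s); rewrite /w' (asboolT Ps) (wP s Ps).1.
have [P'' [sP'' phiP'' [v'' projP'' ev]]] := omega_terms_of_over Ps0 ovP.
exists P''; split=> //; exists v'' => //.
by apply: Some_inj; rewrite -[RHS]/(Some v'') ev -[RHS]v'v' -ev.
Qed.
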